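(* Let $R$ be a commutative ring with identity. If $(X,k_X)$ is a one-point digital image, then its digital homology modules are (up to isomorphism of $R$-modules) $$dH_n(X;R)=\begin{cases}0 & \text{for all } n\ge 1,\\ R & \text{for } n=0.\end{cases}$$
   Context: A digital image is a pair $(X,k_X)$ where $X$ is a finite subset of some $\mathbb{Z}^n$ and $k_X$ is an adjacency relation (symmetric, irreflexive) on $X$. The basic examples are the $k(u,n)$-adjacencies, $1\le u\le n$: distinct $p,q\in\mathbb{Z}^n$ are $k(u,n)$-adjacent if $|p_i-q_i|=1$ for at most $u$ indices $i$ and $p_j=q_j$ for all other indices $j$. A subset $A\subseteq X$ is $k_X$-connected if any two distinct points of $A$ are joined by a finite sequence of distinct points of $A$ in which consecutive points are $k_X$-adjacent. A function $f:X\to Y$ is $(k_X,k_Y)$-continuous if it sends every $k_X$-connected subset of $X$ to a $k_Y$-connected subset of $Y$. The digital standard $n$-simplex is $\Delta^n=\{e_0,\dots,e_n\}\subset\mathbb{Z}^{n+1}$ (standard basis vectors, linearly ordered by index) with $k(2,n+1)$-adjacency, so any two distinct points of $\Delta^n$ are adjacent. $dC_n(X;R)$ is the free $R$-module on all continuous functions $\sigma:\Delta^n\to X$ (digital $n$-simplexes). With $\epsilon_i^n:\Delta^{n-1}\to\Delta^n$ the order-preserving injection omitting $e_i$, $\partial_n\sigma=\sum_{i=0}^n(-1)^i\sigma\circ\epsilon_i^n$ for $n\ge1$, and $\partial_0=0$. The $n$th digital homology module is $dH_n(X;R)=\ker\partial_n/\operatorname{im}\partial_{n+1}$. *)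

(* Defs.v *)
From HB Require Import structures.
From mathcomp Require Import all_boot all_order all_algebra.
From mathcomp Require Import finmap generic_quotient ring_quotient.
From mathcomp Require Import boolp zify.

Set Implicit Arguments.
Unset Strict Implicit.
Unset Printing Implicit Defensive.

Import Order.TTheory GRing.Theory Num.Theory.
Local Open Scope ring_scope.
Local Open Scope quotient_scope.

Section QuotientModule.
Variables (R : pzRingType) (V : lmodType R) (S : submodClosed V).

(* [Quotient.quot] is only a quotient of additive groups, of a predicate with a
   [zmodClosed] structure; the scaling is added below. *)
Definition submod_pred : {pred V} := S.
HB.instance Definition _ :=
  GRing.isZmodClosed.Build V submod_pred (GRing.submod_closedB (submodClosedP S)).

Definition quot_lmod : Type := Quotient.quot submod_pred.
HB.instance Definition _ := GRing.Zmodule.on quot_lmod.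
HB.instance Definition _ := EqQuotient.on quot_lmod.

Definition quot_pi (x : V) : quot_lmod := \pi_(quot_lmod) x.

Lemma quot_eqE (x y : V) : (quot_pi x == quot_pi y) = (x - y \in S).
Proof. exact/esym/(Quotient.idealrBE submod_pred x y). Qed.

Lemma quot_reprK (x : quot_lmod) : quot_pi (repr x) = x.
Proof. exact: reprK. Qed.

Lemma quot_piD (x y : V) : quot_pi (x + y) = quot_pi x + quot_pi y.
Proof. exact: (raddfD (\pi_(Quotient.quot submod_pred))). Qed.

Definition quot_scale (a : R) (x : quot_lmod) : quot_lmod :=
  quot_pi (a *: repr x).

Lemma quot_piZ (a : R) (x : V) : quot_pi (a *: x) = quot_scale a (quot_pi x).
Proof.
apply/eqP; rewrite quot_eqE -scalerBr rpredZ // -quot_eqE.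
by rewrite quot_reprK.
Qed.

Lemma quot_scaleA a b x :
  quot_scale a (quot_scale b x) = quot_scale (a * b) x.
Proof. by rewrite -(quot_reprK x) -!quot_piZ scalerA. Qed.

Lemma quot_scale1 : left_id 1 quot_scale.
Proof. by move=> x; rewrite -(quot_reprK x) -quot_piZ scale1r. Qed.

Lemma quot_scaleDr : right_distributive quot_scale +%R.
Proof.
move=> a x y; rewrite -(quot_reprK x) -(quot_reprK y).
by rewrite -quot_piD -!quot_piZ -quot_piD scalerDr.
Qed.

Lemma quot_scaleDl x : {morph quot_scale^~ x : a b / a + b}.
Proof. by move=> a b; rewrite -(quot_reprK x) -!quot_piZ -quot_piD scalerDl. Qed.

HB.instance Definition _ := GRing.Zmodule_isLmodule.Build R quot_lmod
  quot_scaleA quot_scale1 quot_scaleDr quot_scaleDl.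
End QuotientModule.

Section Homology.
Variables (R : pzRingType) (U V W : lmodType R).
Variables (d' : {linear U -> V}) (d : {linear V -> W}).

Definition kernel_pred : {pred V} := fun v => d v == 0.

Lemma kernel_submod_closed : submod_closed kernel_pred.
Proof.
split; first by rewrite unfold_in raddf0.
by move=> a u v /eqP du /eqP dv; rewrite unfold_in linearP du dv scaler0 addr0.
Qed.
HB.instance Definition _ :=
  GRing.isSubmodClosed.Build R V kernel_pred kernel_submod_closed.

Record kernel := Kernel { kernel_val :> V; _ : kernel_val \in kernel_pred }.
HB.instance Definition _ := [isSub for kernel_val].
HB.instance Definition _ := [Choice of kernel by <:].
HB.instance Definition _ := [SubChoice_isSubLmodule of kernel by <:].

Definition image_pred : {pred kernel} := fun z => `[< exists u, d' u = val z >].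

Lemma image_submod_closed : submod_closed image_pred.
Proof.
split; first by apply/asboolP; exists 0; rewrite !raddf0.
move=> a x y /asboolP[u Hu] /asboolP[v Hv]; apply/asboolP.
by exists (a *: u + v); rewrite !linearP Hu Hv.
Qed.
HB.instance Definition _ :=
  GRing.isSubmodClosed.Build R kernel image_pred image_submod_closed.

(* [image_pred] is [im d'] seen in [ker d]. It is all of [im d'] when [d \o d']
   vanishes, which [boundary_boundary] proves in the case of interest. *)
Definition homology : lmodType R := quot_lmod image_pred.
End Homology.

Record digital_image := DigitalImage {
  dim : nat;
  points :> {fset 'rV[int]_dim};
  adj : rel points;
  adj_sym : symmetric adj;
  adj_irr : irreflexive adj
}.

(* The k(u,n)-adjacency of Z^n. *)
Definition kadj (u n : nat) : rel 'rV[int]_n := fun p q =>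
  [&& p != q,
      [forall i, (`|p ord0 i - q ord0 i| == 1) || (p ord0 i == q ord0 i)] &
      (#|[set i | `|p ord0 i - q ord0 i|%R == 1%R]| <= u)%N].

Definition dconnected (X : digital_image) (A : {set X}) : Prop :=
  forall x y, x \in A -> y \in A -> x != y ->
  exists s : seq X, [/\ {subset s <= A}, uniq (x :: s),
                        path (@adj X) x s & last x s = y].

Definition dcontinuous (X Y : digital_image) (f : X -> Y) : Prop :=
  forall A : {set X}, dconnected A -> dconnected (f @: A).

Section StandardSimplex.
Variable n : nat.

Definition std_points : {fset 'rV[int]_n.+1} :=
  [fset delta_mx 0 i | i in 'I_n.+1]%fset.

Definition std_adj : rel std_points := fun p q => kadj 2 (val p) (val q).

Lemma std_adj_sym : symmetric std_adj.
Proof.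
move=> p q; rewrite /std_adj /kadj eq_sym; congr [&& _, _ & _].
  by apply: eq_forallb => i; rewrite distrC [X in _ || X]eq_sym.
by congr (_ <= _)%N; apply: eq_card => i; rewrite !inE distrC.
Qed.

Lemma std_adj_irr : irreflexive std_adj.
Proof. by move=> p; rewrite /std_adj /kadj eqxx. Qed.

Definition std_simplex := DigitalImage std_adj_sym std_adj_irr.

Lemma vertex_subproof (i : 'I_n.+1) :
  (delta_mx 0 i : 'rV[int]_n.+1) \in std_points.
Proof. by apply/imfsetP; exists i. Qed.

Definition vertex (i : 'I_n.+1) : std_simplex := FSetSub (vertex_subproof i).

Definition vertex_index (p : std_simplex) : 'I_n.+1 :=
  odflt ord0 [pick i | p == vertex i].

Lemma vertex_inj : injective vertex.
Proof.
move=> i j /(congr1 val) /= /matrixP/(_ 0 i); rewrite !mxE !eqxx /=.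
by case: eqP.
Qed.

Lemma vertexK : cancel vertex vertex_index.
Proof.
move=> i; rewrite /vertex_index; case: pickP => [j /eqP/vertex_inj //|].
by move=> /(_ i); rewrite eqxx.
Qed.

Lemma vertex_indexK : cancel vertex_index vertex.
Proof.
suff H p : exists i, p = vertex i by move=> p; have [i ->] := H p; rewrite vertexK.
by have /imfsetP[i _ Hi] := valP p; exists i; apply: val_inj.
Qed.

Lemma std_adjT (p q : std_simplex) : p != q -> adj p q.
Proof.
rewrite -(vertex_indexK p) -(vertex_indexK q).
move: (vertex_index p) (vertex_index q) => i j; rewrite (inj_eq vertex_inj) => ij.
rewrite /= /std_adj /kadj /= -[X in X && _]/(val (vertex i) != val (vertex j)).
rewrite (inj_eq val_inj) (inj_eq vertex_inj) ij /=.
apply/andP; split.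
  apply/forallP=> k; rewrite !mxE !eqxx /=.
  have [->|_] := eqVneq k i; first by rewrite (negPf ij).
  by case: (k == j).
apply: leq_trans (_ : #|[set i; j]| <= 2)%N; last by rewrite cards2; case: (_ != _).
apply: subset_leq_card; apply/subsetP=> k; rewrite !inE !mxE !eqxx /=.
by case: (k == i); case: (k == j).
Qed.

Lemma std_connected (A : {set std_simplex}) : dconnected A.
Proof.
move=> x y _ yA xy; exists [:: y]; split=> //=.
- by move=> z; rewrite inE => /eqP->.
- by rewrite inE xy.
- by rewrite andbT; exact: std_adjT.
Qed.
End StandardSimplex.

(* The order-preserving injection omitting the vertex of index [i]. *)
Definition coface (n : nat) (i : 'I_n.+2) (p : std_simplex n) : std_simplex n.+1 :=
  vertex (lift i (vertex_index p)).

Section Chains.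
Variable X : digital_image.

Definition dsimplex (n : nat) :=
  {s : {ffun std_simplex n -> X} | `[< dcontinuous s >]}.
HB.instance Definition _ n := Finite.on (dsimplex n).

Lemma dface_subproof n (i : 'I_n.+2) (s : dsimplex n.+1) :
  `[< dcontinuous [ffun p => val s (coface i p)] >].
Proof.
have /asboolP cs := valP s; apply/asboolP => A _.
have -> : [ffun p => val s (coface i p)] @: A = val s @: (coface i @: A).
  by rewrite -imset_comp; apply: eq_imset => p; rewrite ffunE.
exact/cs/std_connected.
Qed.

Definition dface n (i : 'I_n.+2) (s : dsimplex n.+1) : dsimplex n :=
  exist _ [ffun p => val s (coface i p)] (dface_subproof i s).

Variable R : comPzRingType.

(* A digital image has finitely many simplexes in each dimension, so the free
   module on them consists of all functions. *)
Definition dC (n : nat) : lmodType R := {ffun dsimplex n -> R^o}.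

Definition dsimplex_chain n (s : dsimplex n) : dC n :=
  [ffun t => (t == s)%:R].

(* In degree 0 the codomain [dC 0.-1] is [dC 0]; it is irrelevant since the
   map is zero. *)
Definition boundary (n : nat) : dC n -> dC n.-1 :=
  match n with
  | 0 => fun=> 0
  | m.+1 => fun c => \sum_(s : dsimplex m.+1)
      (c s : R) *: \sum_(i < m.+2) (-1 : R) ^+ i *: dsimplex_chain (dface i s)
  end.

Arguments boundary : simpl never.

Lemma boundary_is_linear n : linear (@boundary n).
Proof.
case: n => [|n] a u v; rewrite /boundary; first by rewrite scaler0 addr0.
rewrite scaler_sumr -big_split; apply: eq_bigr => s _ /=.
by rewrite !ffunE scalerDl scalerA.
Qed.
HB.instance Definition _ n :=
  GRing.isLinear.Build R (dC n) (dC n.-1) _ (@boundary n) (@boundary_is_linear n).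

Lemma boundary_chain n (s : dsimplex n.+1) :
  boundary (dsimplex_chain s)
  = \sum_(i < n.+2) (-1 : R) ^+ i *: dsimplex_chain (dface i s).
Proof.
rewrite /boundary (bigD1 s) //= [X in _ + X]big1 ?addr0 => [|t ts].
  by rewrite ffunE eqxx scale1r.
by rewrite ffunE (negPf ts) scale0r.
Qed.

Lemma dface_dface n (i : 'I_n.+3) (j : 'I_n.+2) (s : dsimplex n.+2) :
  (j < i)%N ->
  dface j (dface i s) = dface (inord i.-1) (dface (inord j) s).
Proof.
move=> ji; apply: val_inj; apply/ffunP=> p; rewrite /= !ffunE.
rewrite /coface !vertexK; congr (val s (vertex _)); apply: val_inj => /=.
have := ltn_ord i; have := ltn_ord j => hj hi.
rewrite !inordK; [|lia..].
rewrite /bump; move: (val (vertex_index p)) => k.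
case: (leqP j k) => jk; case: (leqP i.-1 k) => ik; rewrite ?add1n ?add0n; lia.
Qed.

Lemma boundary_boundary n (c : dC n.+1) : boundary (boundary c) = 0.
Proof.
case: n c => [//|n] c.
rewrite [boundary c]/boundary linear_sum big1 // => s _.
rewrite linearZ linear_sum /=.
rewrite (eq_bigr (fun i : 'I_n.+3 => \sum_(j < n.+2)
   (-1 : R) ^+ (i + j) *: dsimplex_chain (dface j (dface i s)))); last first.
  move=> i _; rewrite linearZ /= boundary_chain scaler_sumr.
  by apply: eq_bigr => j _; rewrite scalerA exprD.
rewrite pair_big /= (bigID (fun p : 'I_n.+3 * 'I_n.+2 => (p.2 < p.1)%N)) /=.
rewrite [X in _ + X](reindex_onto
   (fun p : 'I_n.+3 * 'I_n.+2 => (inord p.2 : 'I_n.+3, inord p.1.-1 : 'I_n.+2))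
   (fun p : 'I_n.+3 * 'I_n.+2 => (inord p.2.+1 : 'I_n.+3, inord p.1 : 'I_n.+2))).
  rewrite [X in _ + X](eq_bigl (fun p : 'I_n.+3 * 'I_n.+2 => (p.2 < p.1)%N)).
    rewrite -big_split big1 ?scaler0 //= => -[i j] /= ji.
    have := ltn_ord i; have := ltn_ord j => hj hi.
    rewrite (dface_dface _ ji) !inordK; [|lia..].
    rewrite -scalerDl; have -> : (i + j = (j + i.-1).+1)%N by lia.
    by rewrite exprS mulN1r addNr scale0r.
  move=> [i j] /=; have := ltn_ord i; have := ltn_ord j => hj hi.
  rewrite -leqNgt inordK; last lia.
  rewrite inordK; last lia.
  apply/idP/idP => [/andP[ij /eqP[/(congr1 val) /= e _]]|ji].
    by move: e; rewrite inordK; lia.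
  rewrite xpair_eqE -!val_eqE /= !inordK; lia.
move=> [i j] /=; rewrite -leqNgt => ij.
have := ltn_ord i; have := ltn_ord j => hj hi.
by apply/eqP; rewrite xpair_eqE -!val_eqE /= !inordK; lia.
Qed.
End Chains.

Definition dH (R : comPzRingType) (X : digital_image) (n : nat) : lmodType R :=
  homology (@boundary X R n.+1) (@boundary X R n).

(* Main.v *)
(* An image with a single point has exactly one simplex in each dimension, so a
   chain is determined by its value on any simplex and the boundary map of
   degree n + 1 is multiplication by the alternating sum of n + 2 signs, which
   is 1 for odd n and 0 for even n. *)
Require Import Defs.
From HB Require Import structures.
From mathcomp Require Import all_boot all_order all_algebra finmap.
From mathcomp Require Import boolp.
Import GRing.Theory.
Local Open Scope ring_scope.

(** The chosen representatives of [z] and [0] differ by a cycle, which exactness makes a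
    boundary. *)
Lemma homology_eq0 (R : pzRingType) (U V W : lmodType R)
    (d' : {linear U -> V}) (d : {linear V -> W}) :
  (forall v, d v = 0 -> exists u, d' u = v) -> forall z : homology d' d, z = 0.
Proof.
move=> exact_d z; rewrite -[z]quot_reprK -[0]quot_reprK.
apply/eqP; rewrite quot_eqE; apply/asboolP/exact_d.
by set k := _ - _; have /eqP := valP k.
Qed.

(** Since [d'] vanishes, each class holds a single cycle, so taking [repr] involves no choice and is
    linear; since [d] vanishes, every vector is a cycle, which gives the inverse. *)
Lemma homology_zero_maps (R : pzRingType) (U V W : lmodType R)
    (d' : {linear U -> V}) (d : {linear V -> W}) :
  d' =1 (fun=> 0) -> d =1 (fun=> 0) ->
  exists f : {linear homology d' d -> V}, bijective f.
Proof.
move=> d'0 d0.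
have im0 (x y : kernel d) :
    quot_pi (@image_pred _ _ _ _ d' d) x = quot_pi _ y -> val x = val y.
  move/eqP; rewrite quot_eqE => /asboolP[u]; rewrite d'0 raddfB /=.
  by move/esym/eqP; rewrite subr_eq0 => /eqP.
pose f (z : homology d' d) : V := val (repr z).
have f_pi x : f (quot_pi _ x) = val x by apply: im0; rewrite quot_reprK.
have f_lin : linear f.
  move=> a x y; rewrite -[x]quot_reprK -[y]quot_reprK.
  rewrite -[a *: quot_pi _ _]quot_piZ -quot_piD !f_pi.
  exact: linearP.
have ker v : v \in kernel_pred d by rewrite unfold_in d0.
pose F := GRing.isLinear.Build R (homology d' d) V _ f f_lin.
pose fL : {linear homology d' d -> V} := HB.pack f F.
exists fL; exists (fun v => quot_pi _ (Kernel (ker v))) => [z|v] /=.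
  by rewrite -[RHS]quot_reprK; congr quot_pi; apply: val_inj.
exact: f_pi.
Qed.

Lemma point_eq (X : digital_image) (X1 : #|` points X| = 1%N) (x y : X) : x = y.
Proof.
have /eqP/cardfs1P[a Xa] := X1.
suff val_a (z : X) : val z = a by apply: val_inj; rewrite !val_a.
by apply/fset1P; rewrite -Xa; apply: valP.
Qed.

Lemma dsimplex_eq (X : digital_image) (X1 : #|` points X| = 1%N) (n : nat)
  (s t : dsimplex X n) : s = t.
Proof. by apply/val_inj/ffunP => p; apply: point_eq. Qed.

Lemma dsimplex_inhabited (X : digital_image) (X1 : #|` points X| = 1%N)
  (n : nat) : inhabited (dsimplex X n).
Proof.
have /eqP/cardfs1P[a Xa] := X1.
have aX : a \in points X by rewrite Xa inE.
(* The constant map is continuous: connectedness only constrains pairs of distinct points, and there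
   are none. *)
split; exists [ffun=> FSetSub aX]; apply/asboolP => A _ x y _ _.
by rewrite (point_eq X X1 x y) eqxx.
Qed.

Lemma sum_signr (R : pzRingType) (n : nat) :
  \sum_(i < n) (-1 : R) ^+ i = (odd n)%:R.
Proof.
elim: n => [|n IHn]; first by rewrite big_ord0.
rewrite big_ord_recr /= IHn -signr_odd.
by case: (odd n); rewrite /= ?expr1 ?subrr ?add0r.
Qed.

Lemma boundary_one_point (R : comPzRingType) (X : digital_image)
    (X1 : #|` points X| = 1%N) (n : nat) (c : dC X R n.+1)
    (s : dsimplex X n.+1) (t : dsimplex X n) :
  boundary c t = c s * (odd n)%:R.
Proof.
rewrite /boundary (bigD1 s) //= [X in _ + X]big1 ?addr0; last first.
  by move=> u /eqP[]; apply: dsimplex_eq.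
rewrite ffunE sum_ffunE; congr (_ * _).
(* There are [n.+2] faces, and [odd n.+2] computes to the double negation of [odd n]. *)
rewrite -[odd n]negbK -/(odd n.+2) -sum_signr; apply: eq_bigr => i _.
by rewrite !ffunE (dsimplex_eq X X1 n t (dface i s)) eqxx [_ *: _]mulr1.
Qed.

Theorem proposition3p14 (R : comPzRingType) (X : digital_image)
    (X1 : #|` points X| = 1%N) :
  (forall n : nat, (1 <= n)%N -> forall z : dH R X n, z = 0) /\
  (exists f : {linear dH R X 0 -> R^o}, bijective f).
Proof.
split=> [[//|n] _|].
  have [s] := dsimplex_inhabited X X1 n.+1.
  have [t] := dsimplex_inhabited X X1 n.
  have [u] := dsimplex_inhabited X X1 n.+2.
  (* The constant chain with the value of [v] works for both parities: for even [n] the boundary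
     from degree [n.+2] preserves that value; for odd [n] it kills it, but then [dv] already forces
     [v s = 0]. *)
  apply: homology_eq0 => v dv; exists [ffun=> v s]; apply/ffunP => s'.
  rewrite (boundary_one_point R X X1 n.+1 _ u) ffunE (dsimplex_eq X X1 _ s' s) /=.
  have := congr1 (fun c : dC X R n => c t) dv.
  rewrite (boundary_one_point R X X1 n v s) ffunE.
  by case: (odd n); rewrite ?mulr1 // mulr0 => ->.
have [s] := dsimplex_inhabited X X1 0; have [t] := dsimplex_inhabited X X1 1.
have d10 : @boundary X R 1 =1 (fun=> 0).
  move=> c; apply/ffunP => s'.
  by rewrite (boundary_one_point R X X1 0 c t) mulr0 ffunE.
(* The boundary of degree 0 is zero by computation, hence [frefl]; so [g] identifies the homology
   with [dC X R 0], and evaluation at the only 0-simplex identifies the latter with [R]. *)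
have [g g_bij] := homology_zero_maps _ _ _ _ _ (@boundary X R 0) d10 (frefl _).
pose ev (c : dC X R 0) : R^o := c s.
have ev_lin : linear ev by move=> a c c'; rewrite /ev !ffunE.
pose evL : {linear dC X R 0 -> R^o} :=
  HB.pack ev (GRing.isLinear.Build R (dC X R 0) R^o _ ev ev_lin).
exists (evL \o g); apply: bij_comp g_bij.
exists (fun r => [ffun=> r]) => [c|r]; last by rewrite /= /ev ffunE.
by apply/ffunP => s'; rewrite ffunE (dsimplex_eq X X1 _ s' s).
Qed.
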